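(* If an isoclinism family of groups contains a totally unramified (finite) group, then every finite group in this family is totally unramified. Equivalently: if $G$ and $H$ are isoclinic finite groups and $G$ is totally unramified, then $H$ is totally unramified.
   Context: Groups $G$ and $H$ are isoclinic if there exist isomorphisms $\varphi\colon G/Z(G)\to H/Z(H)$ and $\psi\colon G'\to H'$ (commutator subgroups) compatible with the commutator maps: whenever $\varphi(g_iZ(G))=h_iZ(H)$ for $i=1,2$, then $\psi([g_1,g_2])=[h_1,h_2]$. Isoclinism is an equivalence relation, whose classes are called isoclinism families. All representations are complex. A representation is multiplicity free if it is a direct sum of pairwise non-equivalent irreducible representations; a restriction $\rho|_N$ is called trivial if every element of $N$ acts as the identity. A finite group $G$ is unramified over a nontrivial abelian normal subgroup $N$ if for every irreducible representation $\rho$ of $G$ the restriction $\rho|_N$ is multiplicity free or trivial. A finite group $G$ is totally unramified (recursively) if it is abelian or there exists a nontrivial abelian normal subgroup $N$ such that $G$ is unramified over $N$ and $G/N$ is totally unramified. *)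

(* Defs.v *)
From mathcomp Require Import all_boot all_order all_fingroup all_algebra.
From mathcomp Require Import all_solvable mxrepresentation.

Set Implicit Arguments.
Unset Strict Implicit.
Unset Printing Implicit Defensive.

Import GroupScope.

(* MathComp's [~ x, y] is x^-1 * y^-1 * x * y; the relation does not depend on
   the commutator convention. *)
Definition isoclinic (gT rT : finGroupType)
    (G : {group gT}) (H : {group rT}) : Prop :=
  exists (phi : {morphism (G / 'Z(G)) >-> coset_of 'Z(H)})
         (psi : {morphism [~: G, G] >-> rT}),
    [/\ isom (G / 'Z(G)) (H / 'Z(H)) phi,
        isom [~: G, G] [~: H, H] psi
      & forall (g1 g2 : gT) (h1 h2 : rT),
          g1 \in G -> g2 \in G -> h1 \in H -> h2 \in H ->
          phi (coset 'Z(G) g1) = coset 'Z(H) h1 ->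
          phi (coset 'Z(G) g2) = coset 'Z(H) h2 ->
          psi [~ g1, g2] = [~ h1, h2]].

Definition multiplicity_free (F : fieldType) (gT : finGroupType)
    (G : {group gT}) (n : nat) (rG : mx_representation F G n) : Prop :=
  exists (k : nat) (U : 'I_k -> 'M[F]_n),
    [/\ forall i, mxsimple rG (U i),
        (\sum_(i < k) U i :=: 1%:M%R)%MS,
        mxdirect (\sum_(i < k) U i)
      & forall i j, i != j -> ~ mx_iso rG (U i) (U j)].

Definition trivial_repr (F : fieldType) (gT : finGroupType)
    (G : {group gT}) (n : nat) (rG : mx_representation F G n) : Prop :=
  forall x, x \in G -> rG x = 1%:M%R.

Definition unramified_over (F : fieldType) (gT : finGroupType)
    (G N : {group gT}) (nsNG : N <| G) : Prop :=
  forall (n : nat) (rG : mx_representation F G n),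
    mx_irreducible rG ->
    multiplicity_free (subg_repr rG (normal_sub nsNG))
    \/ trivial_repr (subg_repr rG (normal_sub nsNG)).

Inductive totally_unramified (F : fieldType) :
    forall gT : finGroupType, {group gT} -> Prop :=
| TotallyUnramifiedAbelian (gT : finGroupType) (G : {group gT}) :
    abelian G -> totally_unramified F G
| TotallyUnramifiedStep (gT : finGroupType) (G N : {group gT})
    (nsNG : N <| G) :
    abelian N -> N :!=: 1 -> unramified_over F nsNG ->
    totally_unramified F (G / N)%G -> totally_unramified F G.

(* Main.v *)
Require Import Defs.
From mathcomp Require Import all_boot all_order all_fingroup all_algebra.
From mathcomp Require Import reals complex.
From mathcomp Require Import all_solvable mxrepresentation.

(* For N abelian and normal in G, Clifford theory makes "G is unramified over N"
   a statement about commutators: if K < N is proper and [N, x], [N, y] are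
   contained in K, then [x, y] lies in K. Indeed, for a nontrivial character chi
   of N with kernel K, its stabilizer T consists of the x with [N, x] <= K, and
   chi has multiplicity one in the irreducible representations above it exactly
   when all irreducible representations of T above chi are linear, i.e. when
   [T, T] <= K.

   Taking K to be the intersection of N and G' shows that N <= G' or G' <= N.
   Isoclinic groups G and H are the images of their fibre product L over
   G / Z(G) = H / Z(H), and the two projections p and q have the same kernel on
   L'. If N <= G', put M = q (p^-1 N :&: L'): the commutator condition passes
   from N to M, and L still witnesses that G / N and H / M are isoclinic, so one
   can recurse. If G' <= N, put M = q (p^-1 N), for which H / M is abelian. *)

Set Implicit Arguments.
Unset Strict Implicit.
Unset Printing Implicit Defensive.

Import GroupScope GRing.Theory Num.Theory.

(** * Commutator form of being unramified *)

(** Allowing every proper subgroup [K], and not only kernels of characters, makes [N :&: [~: G, G]]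
    an admissible choice. *)
Definition unramified_comm (gT : finGroupType) (G N : {set gT}) : Prop :=
  forall K : {group gT}, K \proper N ->
  {in G &, forall x y,
    {in N, forall n, [~ n, x] \in K} -> {in N, forall n, [~ n, y] \in K} ->
    [~ x, y] \in K}.

(** * From unramified to the commutator condition *)

Local Open Scope ring_scope.

(** As [N] is abelian, the [U i] are lines; being pairwise non-isomorphic, each is stable under
    every matrix commuting with [N]. Such matrices are simultaneously diagonal. *)
Lemma multiplicity_free_cent_comm (F : closedFieldType) (gT : finGroupType)
    (N : {group gT}) n (rN : mx_representation F N n) :
    abelian N -> multiplicity_free rN ->
  forall A B, centgmx rN A -> centgmx rN B -> A *m B = B *m A.
Proof.
move=> cNN [k [U [simU defU dxU neqU]]].
have linU i : \rank (U i) = 1%N.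
  have splitN := @group_closure_closed_field F gT N.
  exact: (mxsimple_abelian_linear splitN cNN (simU i)).
have stabU A i : centgmx rN A -> (U i *m A <= U i)%MS.
  move=> cNA; pose V := (\sum_(j | j != i) U j)%MS.
  have modU := mxsimple_module (simU i).
  have modV: mxmodule rN V.
    by apply: sumsmx_module => j _; apply: mxsimple_module.
  have dxUV: (U i :&: V = 0)%MS by move/mxdirect_sumsP: dxU; apply.
  have dxVU: (V :&: U i = 0)%MS by rewrite capmxC.
  have fullVU m (W : 'M_(m, n)) : (W <= V + U i)%MS.
    by apply: submx_trans (submx1 W) _; rewrite -defU (bigD1 i) //= addsmxC.
  (* [f] is the component of [A] in [V]. Were it nonzero on [U i], Schur's lemma would make [U i]
     isomorphic to some [U j] with [j != i]. *)
  pose P := proj_mx V (U i); pose f := A *m P.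
  have hom_P: (U i *m A <= dom_hom_mx rN P)%MS.
    by apply: submx_trans (proj_mx_hom dxVU modV modU).
  have hom_f: (U i <= dom_hom_mx rN f)%MS.
    apply/hom_mxP=> x Nx; rewrite mulmxA -(mulmxA _ _ A) -(centgmxP cNA) //.
    by rewrite (mulmxA _ A P) -(hom_mxP hom_P) // (mulmxA _ A).
  have f0: U i *m f = 0.
    apply/eqP/idPn=> nz_f; have isoUf := mx_Schur_inj_iso (simU i) hom_f nz_f.
    have simUf := mx_iso_simple isoUf (simU i).
    have [|||j neq_ji isoUj] :=
      @hom_mxsemisimple_iso _ _ _ _ rN _ (fun j => j != i) _ U 1%:M simUf.
    - by move=> j _.
    - exact: scalar_mx_hom.
    - by rewrite mulmx1 (mulmxA _ A) proj_mx_sub.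
    case: (neqU j i neq_ji); apply: mx_iso_trans isoUj (mx_iso_sym isoUf).
  rewrite -(add_proj_mx dxVU (fullVU n (U i *m A))).
  rewrite -(mulmxA (U i) A P) f0 add0r.
  exact: proj_mx_sub.
move=> A B cA cB; apply/eqP; rewrite -subr_eq0 -[_ - _]mul1mx -submx0.
rewrite -(eqmxMr _ defU) sumsmxMr; apply/sumsmx_subP=> i _.
rewrite submx0 mulmxBr subr_eq0 !mulmxA; apply/eqP.
have [u [_ defu _]] := mxmodule_eigenvector (mxsimple_module (simU i)) (linU i).
have [v defv] : exists v : 'cV_n, U i = v *m u.
  by apply/submxP; rewrite defu.
have eigu C : centgmx rN C -> exists c, u *m C = c *: u.
  by move=> cC; apply/sub_rVP; rewrite -(eqmxMr C defu) -defu stabU.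
have [[b uA] [c uB]] := (eigu A cA, eigu B cB).
rewrite defv -!mulmxA !(mulmxA u) uA uB -!scalemxAl uA uB !scalerA.
by rewrite mulrC.
Qed.

(** By Maschke the regular representation is a sum of irreducible ones, so the group ring element
    with coefficients [a] acts on it as zero; there distinct group elements are linearly
    independent. *)
Lemma group_ring_irr_separated (F : numClosedFieldType) (gT : finGroupType)
    (G : {group gT}) (a : gT -> F) :
    (forall n (rG : mx_representation F G n), mx_irreducible rG ->
      \sum_(g in G) a g *: rG g = 0) ->
  {in G, forall g, a g = 0}.
Proof.
move=> a0 g Gg; pose aG := regular_repr F G.
have F'G : [pchar F]^'.-group G.
  by apply/pgroupP=> p _ _; rewrite inE /= pchar_num.
have [I W /= simW defW _] :=
  dec_mx_reducible_semisimple (mxmodule1 aG) (mx_Maschke_pchar aG F'G).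
have aG0 : \sum_(h in G) a h *: aG h = 0.
  apply/eqP; rewrite -[\sum_(h in G) _]mul1mx -submx0 -(eqmxMr _ defW) sumsmxMr.
  apply/sumsmx_subP=> i _; rewrite -(eqmxMr _ (val_submod1 (W i))).
  have modW := mxsimple_module (simW i).
  have irrW : mx_irreducible (submod_repr modW) by apply/submod_mx_irr.
  rewrite submx0 mulmx_sumr; apply/eqP.
  rewrite -[RHS](linear0 (@val_submod _ _ (W i) _)) -(a0 _ _ irrW) linear_sum.
  apply: eq_bigr => h Gh; rewrite -scalemxAr [RHS]linearZ; congr (_ *: _).
  by rewrite -(val_submodJ modW) // mul1mx.
have /(congr1 (gring_proj g)) := aG0.
rewrite linear0 linear_sum (bigD1 g) //= big1 => [|h /andP[Gh neq_hg]].
  rewrite addr0 linearZ /= gring_projE // eqxx => /matrixP/(_ 0 0).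
  by rewrite !mxE eqxx mulr1.
by rewrite linearZ /= gring_projE // eq_sym (negPf neq_hg) scaler0.
Qed.

Section GroupSum.

Variables (F : fieldType) (gT : finGroupType) (G : {group gT}) (n : nat).
Variable rG : mx_representation F G n.

Definition set_sum_mx (A : {set gT}) : 'M[F]_n := \sum_(g in A) rG g.

Lemma set_sum_mxE (A : {set gT}) :
  A \subset G -> set_sum_mx A = \sum_(g in G) (g \in A)%:R *: rG g.
Proof.
move=> sAG; rewrite (big_setID A) /= (setIidPr sAG) [X in _ + X]big1 ?addr0.
  by apply: eq_bigr => g ->; rewrite scale1r.
by move=> g /setDP[_ /negPf->]; rewrite scale0r.
Qed.

Lemma set_sum_mx_rcoset (A : {set gT}) x :
  A \subset G -> x \in G -> set_sum_mx (A :* x)%g = set_sum_mx A *m rG x.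
Proof.
move=> sAG Gx; rewrite /set_sum_mx mulmx_suml.
rewrite (reindex_inj (mulIg x)) /=.
apply: eq_big => [g|g]; first by rewrite mem_rcoset mulgK.
by rewrite mem_rcoset mulgK => Ag; rewrite repr_mxM // (subsetP sAG).
Qed.

Lemma set_sum_mxJ (A : {set gT}) x :
  A \subset G -> x \in G -> x \in 'N(A)%g ->
  rG x *m set_sum_mx A = set_sum_mx A *m rG x.
Proof.
move=> sAG Gx nAx; rewrite /set_sum_mx mulmx_suml mulmx_sumr.
rewrite (reindex_inj (conjg_inj x)) /=.
apply: eq_big => [g|g]; rewrite memJ_norm // => Ag.
by have Gg := subsetP sAG g Ag; rewrite -!repr_mxM ?groupJ // -conjgC.
Qed.

Lemma group_sum_mx_id (K : {group gT}) x :
  K \subset G -> x \in K -> set_sum_mx K *m rG x = set_sum_mx K.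
Proof.
by move=> sKG Kx; rewrite -set_sum_mx_rcoset ?(subsetP sKG) // rcoset_id.
Qed.

Lemma group_sum_mx_sqr (K : {group gT}) : K \subset G ->
  set_sum_mx K *m set_sum_mx K = #|K|%:R *: set_sum_mx K.
Proof.
move=> sKG; rewrite {2}/set_sum_mx mulmx_sumr.
rewrite (eq_bigr (fun _ => set_sum_mx K)) => [|x]; last exact: group_sum_mx_id.
by rewrite sumr_const scaler_nat.
Qed.

End GroupSum.

(* With E the sum of K, the matrices E x and E y commute with N, hence with each
   other by multiplicity freeness; this gives |K| E x y = |K| E y x. *)
Lemma multiplicity_free_comm_fix (F : numClosedFieldType) (gT : finGroupType)
    (G N K : {group gT}) n (rG : mx_representation F G n) (nsNG : N <| G) x y :
    abelian N -> multiplicity_free (subg_repr rG (normal_sub nsNG)) ->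
    K \subset N -> x \in G -> y \in G ->
    {in N, forall n, [~ n, x]%g \in K} -> {in N, forall n, [~ n, y]%g \in K} ->
  set_sum_mx rG K *m rG [~ x, y]%g = set_sum_mx rG K.
Proof.
move=> cNN mfN sKN Gx Gy Kx Ky; set E := set_sum_mx rG K.
have sNG := normal_sub nsNG; have sKG := subset_trans sKN sNG.
have nKN : N \subset 'N(K)%g.
  by rewrite cents_norm // (subset_trans cNN) // centS.
have EN m : m \in N -> rG m *m E = E *m rG m.
  by move=> Nm; apply: set_sum_mxJ; rewrite ?(subsetP sNG) ?(subsetP nKN).
have ET t : t \in G -> {in N, forall n, [~ n, t]%g \in K} ->
    rG t *m E = E *m rG t.
  move=> Gt Kt; apply: set_sum_mxJ => //; rewrite inE.
  apply/subsetP=> _ /imsetP[k Kk ->].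
  by rewrite conjg_mulR groupM // Kt // (subsetP sKN).
have cENt t : t \in G -> {in N, forall n, [~ n, t]%g \in K} ->
    centgmx (subg_repr rG sNG) (E *m rG t).
  move=> Gt Kt; apply/centgmxP=> m Nm /=; have Gm := subsetP sNG m Nm.
  rewrite mulmxA EN // -!mulmxA -!repr_mxM //.
  (* The factor [[~ m, t]] lies in [K] and is absorbed by [E]. *)
  have -> : (m * t = t * m * [~ m, t])%g.
    by rewrite commgEl -mulgA mulKVg conjgC.
  have Gk := subsetP sKG _ (Kt m Nm); have Gtm := groupM Gt Gm.
  have Etm : rG (t * m)%g *m E = E *m rG (t * m)%g.
    by rewrite repr_mxM // -mulmxA EN // mulmxA ET // -mulmxA.
  by rewrite (repr_mxM _ Gtm Gk) mulmxA -Etm -mulmxA group_sum_mx_id // Kt.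
have cExy := multiplicity_free_cent_comm cNN mfN (cENt x Gx Kx) (cENt y Gy Ky).
have EExy z t : rG z *m E = E *m rG z -> z \in G -> t \in G ->
    E *m rG z *m (E *m rG t) = #|K|%:R *: (E *m rG (z * t)%g).
  move=> Ez Gz Gt; rewrite -mulmxA (mulmxA (rG z)) Ez -mulmxA -repr_mxM //.
  by rewrite mulmxA group_sum_mx_sqr // -scalemxAl.
move: cExy; rewrite !EExy ?ET // => /(scalerI (_ : #|K|%:R != 0)) eqxy.
have Gyx := groupM Gy Gx.
have Eyx : rG (y * x)%g *m E = E *m rG (y * x)%g.
  by rewrite repr_mxM // -mulmxA ET // mulmxA ET // -mulmxA.
have : rG (y * x)%g *m (E *m rG [~ x, y]%g) = rG (y * x)%g *m E.
  rewrite mulmxA Eyx -mulmxA -repr_mxM ?groupR // -eqxy ?pnatr_eq0 -?lt0n //.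
  by congr (_ *m rG _); rewrite commgEl conjgE !mulgA mulgK mulgV mul1g.
move/(congr1 (mulmx (rG (y * x)^-1%g))); rewrite !mulmxA.
by rewrite -repr_mxM ?groupV // mulVg repr_mx1 !mul1mx.
Qed.

(** Take [n] in [N] outside [K]. An irreducible representation kills [1 - n] if it is trivial on
    [N], and [E (c - 1)] if it is multiplicity free there, so the product vanishes in both cases. *)
Lemma unramified_over_comm (F : numClosedFieldType) (gT : finGroupType)
    (G N : {group gT}) (nsNG : N <| G) :
  abelian N -> unramified_over F nsNG -> unramified_comm G N.
Proof.
move=> cNN unrN K ltKN x y Gx Gy Kx Ky; set c := [~ x, y]%g.
have sKN := proper_sub ltKN; have sNG := normal_sub nsNG.
have sKG := subset_trans sKN sNG; have Gc : c \in G by rewrite groupR.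
have [_ [n Nn nKn]] := properP ltKN; have Gn := subsetP sNG n Nn.
apply/idPn=> nKc; have Gnc := groupM Gn Gc.
(* a lists the coefficients of E (1 - n) (c - 1), where E is the sum of K: this
   element of the group ring vanishes in every irreducible representation. *)
pose a g : F := (g \in K :* c)%g%:R - (g \in K :* (n * c))%g%:R
                - (g \in K)%:R + (g \in K :* n)%g%:R.
have coset1 z : (1%g \in K :* z)%g = (z \in K).
  by rewrite mem_rcoset mul1g groupV.
(* Since neither [c] nor [n] lies in [K], this coefficient is -1 or -2, which is nonzero in
   characteristic zero. *)
suffices /eqP : a 1%g = 0.
  rewrite /a !coset1 group1 (negPf nKc) (negPf nKn) addr0 sub0r -opprD oppr_eq0.
  by rewrite -natrD pnatr_eq0 addn1.
apply: (group_ring_irr_separated (G := G)) => // d rG irrG.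
pose E := set_sum_mx rG K.
have -> : \sum_(g in G) a g *: rG g
    = E *m rG c - E *m rG (n * c)%g - E + E *m rG n.
  rewrite -!set_sum_mx_rcoset // /E !(set_sum_mxE rG) ?mul_subG ?sub1set //.
  rewrite -!sumrN -!big_split /=; apply: eq_bigr => g _.
  by rewrite !scalerDl !scaleNr.
have [mfN | trN] := unrN d rG irrG; last first.
  have rGn : rG n = 1%:M := trN n Nn.
  by rewrite (repr_mxM _ Gn Gc) rGn mul1mx mulmx1 subrr sub0r addNr.
have fixE := multiplicity_free_comm_fix cNN mfN sKN Gx Gy Kx Ky.
have En : rG n *m E = E *m rG n.
  apply: set_sum_mxJ => //; apply: (subsetP _ n Nn).
  by rewrite cents_norm // (subset_trans cNN) // centS.
by rewrite (repr_mxM _ Gn Gc) mulmxA -En -mulmxA fixE -/E addrAC subrK subrr.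
Qed.

(** By absolute irreducibility the matrices [rG x] span all matrices, and the identity is bilinear
    in [A] and [B]. *)
Lemma abs_irr_corner_comm (F : fieldType) (gT : finGroupType) (G : {group gT})
    n (rG : mx_representation F G n) (e : 'M_n) :
    mx_absolutely_irreducible rG ->
    {in G &, forall x y,
      e *m rG x *m e *m rG y *m e = e *m rG y *m e *m rG x *m e} ->
  forall A B : 'M_n, e *m A *m e *m B *m e = e *m B *m e *m A *m e.
Proof.
case/mx_abs_irrP=> _ [a defM] eqG A B.
have eqB x : x \in G -> e *m rG x *m e *m B *m e = e *m B *m e *m rG x *m e.
  move=> Gx; rewrite [B]defM !(mulmx_sumr, mulmx_suml); apply: eq_bigr => y Gy.
  by rewrite -!(scalemxAr, scalemxAl) eqG.
rewrite [A]defM !(mulmx_sumr, mulmx_suml); apply: eq_bigr => x Gx.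
by rewrite -!(scalemxAr, scalemxAl) eqB.
Qed.

(** * Weight spaces of a character of [N] *)

Section Weight.

Variables (F : fieldType) (gT : finGroupType) (G N : {group gT}).
Variables (n : nat) (rG : mx_representation F G n) (chi : gT -> F).
Hypotheses (nsNG : N <| G) (cNN : abelian N).
Hypothesis chi1 : chi 1%g = 1.
Hypothesis chiM : {in N &, {morph chi : x y / (x * y)%g >-> x * y}}.

Let sNG := subsetP (normal_sub nsNG).
Let nNG g m : g \in G -> m \in N -> (m ^ g)%g \in N.
Proof. by move=> Gg Nm; rewrite memJ_norm // (subsetP (normal_norm nsNG)). Qed.

(* |N| times the projection onto the weight space of chi. *)
Definition weight_mx : 'M[F]_n := \sum_(m in N) chi m^-1%g *: rG m.
Let e := weight_mx.

Lemma weight_mxJ g : g \in G -> {in N, forall m, chi (m ^ g)%g = chi m} ->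
  rG g *m e = e *m rG g.
Proof.
move=> Gg chiJ; rewrite /e /weight_mx mulmx_suml mulmx_sumr.
rewrite (reindex_inj (conjg_inj g)) /=.
have nNg : g \in 'N(N)%g by rewrite (subsetP (normal_norm nsNG)).
apply: eq_big => [m|m]; rewrite memJ_norm // => Nm.
have Gm := sNG Nm.
rewrite -scalemxAr -scalemxAl -!repr_mxM ?groupJ // -conjgC -conjVg.
by rewrite chiJ ?groupV.
Qed.

Lemma weight_mx_char m : m \in N -> e *m rG m = chi m *: e.
Proof.
move=> Nm; rewrite /e /weight_mx mulmx_suml (reindex_inj (mulIg m^-1%g)) /=.
rewrite scaler_sumr; apply: eq_big => [l|l]; rewrite groupMr ?groupV // => Nl.
rewrite -scalemxAl -repr_mxM ?groupM ?groupV ?sNG // mulgKV invMg invgK.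
by rewrite chiM ?groupV // scalerA.
Qed.

Lemma char_weight_mx m : m \in N -> rG m *m e = chi m *: e.
Proof.
move=> Nm; rewrite weight_mxJ ?weight_mx_char ?sNG // => l Nl.
by rewrite conjgE (centsP cNN _ Nl _ Nm) mulKg.
Qed.

(** In [m * g = g * m ^ g], placed between two factors [e], the elements of [N] are absorbed and
    leave the scalars [chi m] and [chi (m ^ g)]. *)
Lemma weight_mx_cut g m : g \in G -> m \in N -> chi (m ^ g)%g != chi m ->
  e *m rG g *m e = 0.
Proof.
move=> Gg Nm neq_chi; have Gm := sNG Nm.
have: e *m rG (m * g)%g *m e = e *m rG (g * m ^ g)%g *m e by rewrite -conjgC.
rewrite (repr_mxM _ Gm Gg) (repr_mxM _ Gg (groupJ Gm Gg)) !mulmxA.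
rewrite weight_mx_char //.
rewrite -(mulmxA _ (rG (m ^ g)%g)) char_weight_mx ?nNG //.
rewrite -!(scalemxAl, scalemxAr) => /eqP.
rewrite -subr_eq0 -scalerBl scaler_eq0 subr_eq0 eq_sym (negPf neq_chi) /=.
by move/eqP.
Qed.

Lemma weight_mx_row (w : 'rV_n) :
  {in N, forall m, w *m rG m = chi m *: w} -> w *m e = #|N|%:R *: w.
Proof.
move=> wchi; rewrite mulmx_sumr (eq_bigr (fun _ => w)) => [|m Nm].
  by rewrite sumr_const scaler_nat.
by rewrite -scalemxAr wchi // scalerA -chiM ?groupV // mulVg chi1 scale1r.
Qed.

(** It suffices to compare group elements. Those moving [chi] give [e x e = 0]; those fixing it
    commute with [e], and the commutator of two of them acts on the weight space by the scalar 1. *)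
Lemma weight_mx_comm (A B : 'M_n) :
    mx_absolutely_irreducible rG ->
    {in G &, forall x y, {in N, forall m, chi (m ^ x)%g = chi m} ->
      {in N, forall m, chi (m ^ y)%g = chi m} ->
      [~ x, y]%g \in N /\ chi [~ x, y]%g = 1} ->
  e *m A *m e *m B *m e = e *m B *m e *m A *m e.
Proof.
move=> absG chiR; apply: abs_irr_corner_comm absG _ _ _ => x y Gx Gy.
have stabP g : g \in G -> {in N, forall m, chi (m ^ g)%g = chi m}
                   \/ e *m rG g *m e = 0.
  move=> Gg.
  have [/forall_inP fixg | ] := boolP [forall m in N, chi (m ^ g)%g == chi m].
    by left=> m Nm; apply/eqP/fixg.
  rewrite negb_forall_in => /exists_inP[m Nm neq].
  by right; apply: weight_mx_cut neq.
have [[fixx|x0] [fixy|y0]] := (stabP x Gx, stabP y Gy).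
- have [NR chiR1] := chiR x y Gx Gy fixx fixy.
  have slide z t : z \in G -> t \in G ->
      {in N, forall m, chi (m ^ z)%g = chi m} ->
      e *m rG z *m e *m rG t *m e = e *m e *m rG (z * t)%g *m e.
    move=> Gz Gt fixz; rewrite -(mulmxA e (rG z)) weight_mxJ //.
    by rewrite repr_mxM // !mulmxA.
  rewrite !slide //.
  have -> : (x * y = y * x * [~ x, y])%g.
    by rewrite commgEl conjgE !mulgA mulgK mulgV mul1g.
  rewrite (repr_mxM _ (groupM Gy Gx)) ?groupR // -(mulmxA _ _ e).
  rewrite -(mulmxA (rG _)).
  by rewrite char_weight_mx // chiR1 scale1r mulmxA.
- rewrite -!mulmxA (mulmxA e (rG y)) y0 !mulmx0.
  by rewrite !mulmxA y0 !mul0mx.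
- rewrite x0 !mul0mx -!mulmxA (mulmxA e (rG x)) x0.
  by rewrite !mulmx0.
- by rewrite x0 y0 !mul0mx.
Qed.

End Weight.

(* k^-1 e is idempotent in the intended use, and commutativity of its corner
   e M_n e forces it to have rank one. *)
Lemma comm_corner_line (F : fieldType) n (e : 'M[F]_n) (k : F) (u v : 'rV_n) :
    (forall A B : 'M_n, e *m A *m e *m B *m e = e *m B *m e *m A *m e) ->
    k != 0 -> u *m e = k *: u -> v *m e = k *: v -> v != 0 ->
  (u <= v)%MS.
Proof.
move=> eC nzk ue ve nzv; rewrite submxE; apply/eqP/rowP=> j; rewrite [RHS]mxE.
(* The column [c] kills [v] and sends [u] to [a], an entry of [u *m cokermx v]. Applying both sides
   of [eC (c *m v) (c *m u)] to [u] gives [k^3 a^2 v = 0]. *)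
pose c := cokermx v *m delta_mx j (0 : 'I_1).
have vc : v *m c = 0 by rewrite mulmxA mulmx_coker mul0mx.
have uc : u *m c = ((u *m cokermx v) 0 j)%:M.
  by rewrite [LHS]mx11_scalar mulmxA -colE mxE.
set a := (u *m cokermx v) 0 j in uc *.
have uA : u *m (c *m v) = a *: v by rewrite mulmxA uc mul_scalar_mx.
have uB : u *m (c *m u) = a *: u by rewrite mulmxA uc mul_scalar_mx.
have vB : v *m (c *m u) = 0 by rewrite mulmxA vc mul0mx.
move: (c *m v) (c *m u) uA uB vB => A B uA uB vB.
have := congr1 (mulmx u) (eC A B).
rewrite !mulmxA ue -!scalemxAl uA uB -!scalemxAl ve ue -!scalemxAl vB uA.
rewrite mul0mx -!scalemxAl ve !scaler0 !scalerA => /esym/eqP.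
rewrite scaler_eq0 (negPf nzv) orbF !mulf_eq0 (negPf nzk) /= !orbF orbb.
by move/eqP.
Qed.

(** Two isomorphic lines of a decomposition are spanned by vectors [u], [v] of the same weight
    [chi]. The commutator condition for the kernel of [chi] makes the corner of the weight
    projection commutative, so [u] is a multiple of [v], against directness. *)
Lemma unramified_comm_over (F : numClosedFieldType) (gT : finGroupType)
    (G N : {group gT}) (nsNG : N <| G) :
  abelian N -> unramified_comm G N -> unramified_over F nsNG.
Proof.
move=> cNN unrN n rG irrG; pose rN := subg_repr rG (normal_sub nsNG).
have sNG := normal_sub nsNG.
have [/forall_inP trN | ntN] := boolP [forall m in N, rG m == 1%:M].
  by right=> m Nm; apply/eqP/trN.
left; have F'N : [pchar F]^'.-group N.
  by apply/pgroupP=> p _ _; rewrite inE /= pchar_num.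
have splitN := @group_closure_closed_field F gT N.
have absG : mx_absolutely_irreducible rG by apply: group_closure_closed_field.
have [I W /= simW defW dxW] :=
  dec_mx_reducible_semisimple (mxmodule1 rN) (mx_Maschke_pchar rN F'N).
exists #|I|, (fun i => W (enum_val i)); split=> [i|||i j neq_ij isoW].
- exact: simW.
- apply: eqmx_trans defW.
  rewrite [X in (_ :=: X)%MS](reindex (@enum_val I I)) //=.
  exact/onW_bij/enum_val_bij.
- move: dxW; rewrite !mxdirectE /= (reindex (@enum_val I I)) /=; last first.
    exact/onW_bij/enum_val_bij.
  rewrite [X in _ == X -> _](reindex (@enum_val I I)) //=.
  exact/onW_bij/enum_val_bij.
set i' := enum_val i in isoW; set j' := enum_val j in isoW.
have neq_ij' : j' != i' by rewrite (inj_eq enum_val_inj) eq_sym.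
have linW l : \rank (W l) = 1%N.
  exact: (mxsimple_abelian_linear splitN cNN (simW l)).
have [u [chi defu uchi]] :=
  mxmodule_eigenvector (mxsimple_module (simW i')) (linW i').
have nzu : u != 0 by rewrite -mxrank_eq0 -defu linW.
have [f injf homf defWj] := isoW.
pose v := u *m f.
have nzv : v != 0 by rewrite -(mul0mx _ f) (can_eq (mulmxK injf)).
have vchi : {in N, forall m, v *m rG m = chi m *: v}.
  have hom_u : (u <= dom_hom_mx rN f)%MS by rewrite -defu.
  by move=> m Nm; rewrite -[LHS](hom_mxP hom_u) //= uchi // scalemxAl.
have scale_inj (a b : F) : a *: u = b *: u -> a = b.
  move/eqP; rewrite -subr_eq0 -scalerBl scaler_eq0 (negPf nzu) orbF subr_eq0.
  by move/eqP.
have chi1 : chi 1%g = 1.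
  by apply: scale_inj; rewrite -uchi // repr_mx1 mulmx1 scale1r.
have chiM : {in N &, {morph chi : x y / (x * y)%g >-> x * y}}.
  move=> x y Nx Ny; apply: scale_inj; rewrite -uchi ?groupM // repr_mxM //.
  by rewrite mulmxA uchi // -scalemxAl uchi // scalerA.
(* The kernel of [chi], taken as the stabilizer of [u] so that it is a group by construction. *)
pose K := (rstab_group rN u)%G.
have KP m : m \in N -> (m \in K) = (chi m == 1).
  move=> Nm; rewrite inE Nm /= [_ *m _]uchi //.
  apply/eqP/eqP=> [fixu|->]; last exact: scale1r.
  by apply: scale_inj; rewrite fixu scale1r.
have sKN : K \subset N by apply: rstab_sub.
(* Otherwise [N] fixes [u]; as [N] is normal, its fixed space is a [G]-submodule, hence everything,
   and [N] acts trivially. *)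
have ltKN : K \proper N.
  rewrite properE sKN; apply: contra ntN => sNK.
  have fixu : (u <= rfix_mx rG N)%MS.
    by apply/rfix_mxP=> m /(subsetP sNK); rewrite inE => /andP[_ /eqP].
  have [_ irr] := (mx_irrP rG).1 irrG.
  have: row_full (rfix_mx rG N).
    apply: irr; first exact: normal_rfix_mx_module.
    by apply: contraNneq nzu => fix0; rewrite fix0 submx0 in fixu.
  rewrite -sub1mx => /rfix_mxP fix1; apply/forall_inP=> m Nm.
  by rewrite -[rG m]mul1mx fix1.
have chiJ g : g \in G -> {in N, forall m, chi (m ^ g)%g = chi m} ->
    {in N, forall m, [~ m, g]%g \in K}.
  move=> Gg fixg m Nm; have Nmg : (m ^ g)%g \in N.
    by rewrite memJ_norm // (subsetP (normal_norm nsNG)).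
  have NV := groupVr Nm; rewrite commgEl KP; last exact: groupM.
  by rewrite (chiM _ _ NV Nmg) fixg // -chiM // mulVg chi1.
have nzN : #|N|%:R != 0 :> F by rewrite pnatr_eq0 -lt0n cardG_gt0.
have eC A B := weight_mx_comm nsNG cNN chiM A B absG.
have le_uv : (u <= v)%MS.
  apply: (@comm_corner_line F n (weight_mx N rG chi) #|N|%:R) => // [A B||].
  - apply: eC => x y Gx Gy fixx fixy; have Kxy : [~ x, y]%g \in K.
      by apply: unrN; rewrite ?ltKN //; apply: chiJ.
    by have Nxy := subsetP sKN _ Kxy; split=> //; apply/eqP; rewrite -KP.
  - exact: weight_mx_row.
  - exact: weight_mx_row.
have: (u <= W i' :&: \sum_(l | l != i') W l)%MS.
  rewrite sub_capmx defu submx_refl /=; apply: submx_trans le_uv _.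
  by rewrite (sumsmx_sup j') // -defWj submxMr // defu.
by move/mxdirect_sumsP: dxW => -> //; rewrite submx0 (negPf nzu).
Qed.

Lemma unramified_overP (F : numClosedFieldType) (gT : finGroupType)
    (G N : {group gT}) (nsNG : N <| G) :
  abelian N -> unramified_over F nsNG <-> unramified_comm G N.
Proof.
move=> cNN; split; first exact: unramified_over_comm.
exact: unramified_comm_over.
Qed.

Local Close Scope ring_scope.

(** * Isoclinism *)

(* Isoclinism witnessed by a group L mapping onto both groups; in this form it
   passes to quotients by composing p and q with the projections. *)
Definition common_cover (gT rT : finGroupType) (G : {set gT}) (H : {set rT}) :=
  exists (lT : finGroupType) (L : {group lT})
         (p : {morphism L >-> gT}) (q : {morphism L >-> rT}),
    [/\ p @* L = G, q @* L = H
      & {in [~: L, L], forall l, (p l == 1) = (q l == 1)}].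

Lemma isoclinic_common_cover (gT rT : finGroupType)
    (G : {group gT}) (H : {group rT}) :
  isoclinic G H -> common_cover G H.
Proof.
case=> phi [psi [isoPhi isoPsi psiR]].
pose L := [set l : gT * rT | [&& l.1 \in G, l.2 \in H
                               & phi (coset 'Z(G) l.1) == coset 'Z(H) l.2]].
have nZ (hT : finGroupType) (K : {group hT}) : {subset K <= 'N('Z(K))}.
  exact/subsetP/normal_norm/center_normal.
have qG x : x \in G -> coset 'Z(G) x \in G / 'Z(G).
  by move=> Gx; rewrite mem_quotient.
have gL : group_set L.
  apply/group_setP; split=> [|[x1 x2] [y1 y2]].
    by rewrite inE /= !group1 !morph1 eqxx.
  rewrite !inE /= => /and3P[Gx1 Hx2 /eqP phix] /and3P[Gy1 Hy2 /eqP phiy].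
  rewrite !groupM // morphM ?nZ // morphM ?qG // phix phiy.
  by rewrite -morphM ?nZ /=.
exists (gT * rT)%type, (Group gL),
  [morphism of restrm (subsetT _) (@fst gT rT)],
  [morphism of restrm (subsetT _) (@snd gT rT)].
have [injPhi imPhi] := isomP isoPhi; have [injPsi imPsi] := isomP isoPsi.
split; rewrite ?morphim_restrm ?setIid.
- apply/setP=> x; apply/idP/idP=> [/morphimP[[a b] _ /=]|Gx].
    by rewrite inE /= => /and3P[Ga _ _] ->.
  have: phi (coset _ x) \in H / 'Z(H) by rewrite -imPhi mem_morphim ?qG.
  case/morphimP=> h _ Hh phix; have Lxh: (x, h) \in L.
    by rewrite inE /= Gx Hh phix eqxx.
  by apply/morphimP; exists (x, h).
- apply/setP=> y; apply/idP/idP=> [/morphimP[[a b] _ /=]|Hy].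
    by rewrite inE /= => /and3P[_ Hb _] ->.
  have: coset _ y \in H / 'Z(H) by rewrite mem_quotient.
  rewrite -imPhi => /morphimP[_ _ /morphimP[x _ Gx ->] phix].
  have Lxy: (x, y) \in L by rewrite inE /= Gx Hy phix eqxx.
  by apply/morphimP; exists (x, y).
(* The graph of [psi]. Compatibility with commutators puts [[~: L, L]] inside it, and injectivity of
   [psi] then gives the condition on kernels. *)
pose S := [set l : gT * rT | (l.1 \in [~: G, G]) && (psi l.1 == l.2)].
have gS : group_set S.
  apply/group_setP; split=> [|[x1 x2] [y1 y2]].
    by rewrite inE group1 morph1 /=.
  rewrite !inE /= => /andP[Gx /eqP <-] /andP[Gy /eqP <-].
  by rewrite groupM // morphM /=.
have sLS : [~: L, L] \subset Group gS.
  rewrite gen_subG; apply/subsetP=> z /imset2P[[x1 x2] [y1 y2] Lx Ly ->].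
  move: Lx Ly; rewrite !inE /=.
  move=> /and3P[Gx1 Hx2 /eqP phix] /and3P[Gy1 Hy2 /eqP phiy].
  by rewrite mem_commg //=; apply/eqP/psiR.
move=> [x y] /(subsetP sLS) /[!inE]/= /andP[Gx /eqP <-].
by rewrite /restrm /= morph_injm_eq1.
Qed.

(** * Transfer along a common cover *)

Section CommonCover.

Variables (gT rT lT : finGroupType) (L : {group lT}).
Variables (p : {morphism L >-> gT}) (q : {morphism L >-> rT}).
Hypothesis pq1 : {in [~: L, L], forall l, (p l == 1) = (q l == 1)}.

Let sL'L : {subset [~: L, L] <= L}.
Proof. exact: (subsetP (der_sub 1 L)). Qed.

Lemma cover_eq : {in [~: L, L] &, forall l m, (p l == p m) = (q l == q m)}.
Proof.
move=> l m L'l L'm; have [Ll Lm] := (sL'L L'l, sL'L L'm).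
rewrite (eq_mulgV1 (p l)) (eq_mulgV1 (q l)) -(morphV p Lm) -(morphV q Lm).
have Lm' := groupVr Lm; rewrite -(morphM p Ll Lm') -(morphM q Ll Lm').
by rewrite pq1 ?groupM ?groupVr.
Qed.

(** Inside [[~: L, L]] two elements have equal images under [p] exactly when they do under [q],
    hence the intersection. *)
Lemma cover_mem (A : {set lT}) :
  {in [~: L, L], forall l,
    (p l \in p @* (A :&: [~: L, L])) = (q l \in q @* (A :&: [~: L, L]))}.
Proof.
move=> l L'l; apply/morphimP/morphimP=> [] [m Lm /setIP[Am L'm] /eqP eq_lm];
  by exists m; rewrite ?inE ?Am //; apply/eqP; rewrite ?cover_eq // -?cover_eq.
Qed.

Lemma cover_quotient (N : {group gT}) (M : {group rT}) :
    p @* L \subset 'N(N) -> q @* L \subset 'N(M) ->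
    {in [~: L, L], forall l, (p l \in N) = (q l \in M)} ->
  common_cover (p @* L / N) (q @* L / M).
Proof.
move=> nNL nML eqNM.
have sLp : L \subset p @*^-1 'N(N) by rewrite -sub_morphim_pre.
have sLq : L \subset q @*^-1 'N(M) by rewrite -sub_morphim_pre.
exists lT, L, [morphism of restrm sLp (coset N \o p)],
  [morphism of restrm sLq (coset M \o q)].
split; rewrite ?morphim_restrm ?setIid ?morphim_comp // => l L'l.
have Ll := sL'L L'l.
have [Npl Nql] : p l \in 'N(N) /\ q l \in 'N(M).
  by rewrite (subsetP nNL) ?(subsetP nML) ?mem_morphim.
have coset_eq1 (hT : finGroupType) (K : {group hT}) x :
  x \in 'N(K) -> (coset K x == 1) = (x \in K).
  by move=> Nx; rewrite (sameP eqP (kerP _ Nx)) ker_coset.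
by rewrite /restrm /= !coset_eq1 ?eqNM.
Qed.

(** A proper subgroup [K] of [q @* A] is transported to [K0], built inside [[~: L, L]]: for
    commutators, membership in [K0] through [p] is membership in [K] through [q]. *)
Lemma cover_unramified_comm (A : {group lT}) :
    A \subset L -> (A \subset [~: L, L]) || ([~: L, L] \subset A) ->
  unramified_comm (p @* L) (p @* A) -> unramified_comm (q @* L) (q @* A).
Proof.
move=> sAL AL' unrA K ltKM _ _ /morphimP[x Lx _ ->] /morphimP[y Ly _ ->] Kx Ky.
have L'xy: [~ x, y] \in [~: L, L] by rewrite mem_commg.
pose B := (q @*^-1 K)%G; pose K0 := (p @* (B :&: [~: L, L]))%G.
have K0P l : l \in [~: L, L] -> (p l \in K0) = (q l \in K).
  move=> L'l; have Ll := sL'L L'l; rewrite cover_mem //.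
  apply/morphimP/idP=> [[m Lm /setIP[/morphpreP[_ Km] _] ->] //|Kl].
  by exists l; rewrite // inE L'l andbT; apply/morphpreP.
have K0comm z : z \in L -> {in q @* A, forall m, [~ m, q z] \in K} ->
    {in p @* A, forall n, [~ n, p z] \in K0}.
  move=> Lz Kz _ /morphimP[l Ll Al ->]; rewrite -morphR ?K0P ?mem_commg //.
  by rewrite morphR // Kz // mem_morphim.
rewrite -morphR // -K0P //.
have [sK0N | ] := boolP (K0 \proper p @* A).
  by rewrite morphR //; apply: unrA; rewrite ?mem_morphim //; apply: K0comm.
(* If [A] lies in [[~: L, L]], properness of [K] passes to [K0], a contradiction. Otherwise [K0] is
   all of [p @* A], which contains the image of [[~: L, L]]. *)
case/orP: AL' => [sAL' | sL'A].
  have defA: A :&: [~: L, L] = A by apply/setIidPl.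
  case/negP; apply/properP; split.
    apply/subsetP=> _ /morphimP[l Ll /setIP[/morphpreP[_ Kl] L'l] ->].
    by rewrite -defA cover_mem // defA (subsetP (proper_sub ltKM)).
  have [_ [_ /morphimP[l Ll Al ->] nKl]] := properP ltKM.
  by exists (p l); [apply: mem_morphim | rewrite K0P // (subsetP sAL')].
have sK0: K0 \subset p @* A by rewrite morphimS // subIset // sL'A orbT.
rewrite properE sK0 negbK => /subsetP-> //.
apply: mem_morphim; [exact: sL'L | exact: (subsetP sL'A)].
Qed.

Lemma cover_abelian (A : {group lT}) :
  A \subset L -> abelian (p @* A) -> abelian (q @* A).
Proof.
move=> sAL /centsP cAA; apply/centsP=> _ /morphimP[x Lx Ax ->].
move=> _ /morphimP[y Ly Ay ->]; apply/commgP.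
rewrite -morphR // -pq1 ?mem_commg //.
by rewrite morphR //; apply/commgP/cAA; rewrite mem_morphim.
Qed.

End CommonCover.

(** Normality of [N] puts every [[~ n, t]] in [N :&: [~: G, G]], so if this is proper in [N] the
    condition applies to all pairs in [G]. *)
Lemma unramified_comm_der (gT : finGroupType) (G N : {group gT}) :
  N <| G -> unramified_comm G N ->
  (N \subset [~: G, G]) || ([~: G, G] \subset N).
Proof.
case/andP=> sNG nNG unrN; apply/orP.
have [ltKN | ] := boolP (N :&: [~: G, G] \proper N); last first.
  by rewrite properE subsetIl negbK subsetI subxx; left.
right; rewrite gen_subG; apply/subsetP=> z /imset2P[x y Gx Gy ->].
suffices /setIP[]: [~ x, y] \in N :&: [~: G, G] by [].
have comK t : t \in G -> {in N, forall n, [~ n, t] \in N :&: [~: G, G]}.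
  move=> Gt n Nn; apply/setIP.
  split; last by rewrite mem_commg // (subsetP sNG).
  by rewrite commgEl groupM ?groupV // memJ_norm // (subsetP nNG).
exact: (unrN _ ltKN) (comK _ Gx) (comK _ Gy).
Qed.

Lemma totally_unramified_cover (F : numClosedFieldType)
    (gT rT : finGroupType) (G : {group gT}) (H : {group rT}) :
  common_cover G H -> totally_unramified F G -> totally_unramified F H.
Proof.
move=> coverGH tuG; elim: tuG rT H coverGH => {gT G}.
  move=> gT G cGG rT H [lT [L [p [q [defG defH pq1]]]]].
  by left; rewrite -defH; apply: (cover_abelian pq1) => //; rewrite defG.
move=> gT G N nsNG cNN ntN unrN _ IH rT H [lT [L [p [q [defG defH pq1]]]]].
(* With [H] not abelian, [[~: H, H]] is nontrivial, and so is any subgroup containing it; this is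
   used when [[~: G, G]] lies in [N]. *)
have [cHH | ncHH] := boolP (abelian H); first by left.
have [sNG nNG] := andP nsNG.
have unrNG := (unramified_overP F nsNG cNN).1 unrN.
have finish (A : {group lT}) : A <| L ->
    (A \subset [~: L, L]) || ([~: L, L] \subset A) -> p @* A = N ->
    q @* A != 1 ->
    totally_unramified F (H / (q @* A))%G -> totally_unramified F H.
  move=> nsAL AL' defN ntM tuM; have sAL := normal_sub nsAL.
  have nsMH : (q @* A)%G <| H by rewrite -defH morphim_normal.
  have cMM : abelian (q @* A) by apply: (cover_abelian pq1); rewrite ?defN.
  apply: (TotallyUnramifiedStep (nsNG := nsMH)) => //.
  apply/(unramified_overP F nsMH cMM); rewrite -defH.
  by apply: (cover_unramified_comm pq1) => //; rewrite defG defN.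
have defpN : p @* (p @*^-1 N) = N by rewrite morphpreK // defG.
have sL'L := der_sub 1 L.
have defG' : p @* [~: L, L] = [~: G, G] by rewrite morphimR // defG.
have nspN : p @*^-1 N <| L.
  rewrite /normal subsetIl; apply: subset_trans (morphpre_norm p N).
  by rewrite -sub_morphim_pre // defG.
case/orP: (unramified_comm_der nsNG unrNG) => [sNG' | sG'N].
  (* The intersection still maps onto [N], as [N] lies in the image of [[~: L, L]], and it makes
     [pq1] and [cover_mem] available for [A]. *)
  pose A := (p @*^-1 N :&: [~: L, L])%G.
  have nsAL : A <| L by apply: normalI => //; apply: (der_normal 1 L).
  have sAL' : A \subset [~: L, L] by apply: subsetIr.
  have defN : p @* A = N.
    apply/eqP; rewrite eqEsubset -{1}defpN morphimS ?subsetIl //=.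
    apply/subsetP=> n Nn; have: n \in p @* [~: L, L].
      by rewrite defG' (subsetP sNG').
    case/morphimP=> l Ll L'l defn; rewrite defn mem_morphim //.
    by apply/setIP; split=> //; apply/morphpreP; rewrite -defn.
  apply: (finish A) => //; rewrite ?sAL' //.
    apply: contraNneq ntN => M1; rewrite -subG1 -defN.
    apply/subsetP=> _ /morphimP[l Ll Al ->]; apply/set1P/eqP.
    by rewrite pq1 ?(subsetP sAL') // -in_set1 -[[set 1]]M1 mem_morphim.
  apply: IH; rewrite /= -defG -defH.
  apply: (cover_quotient (M := (q @* A)%G)).
  - by rewrite defG.
  - by rewrite normal_norm // morphim_normal.
  by move=> l L'l; rewrite -(cover_mem pq1) // -[p @* _]/(p @* A) defN.
pose A := (p @*^-1 N)%G.
have sL'A : [~: L, L] \subset A by rewrite -sub_morphim_pre // defG'.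
have sH'M : [~: H, H] \subset q @* A.
  by rewrite -defH -morphimR // morphimS.
apply: (finish A); rewrite ?sL'A ?orbT //.
  by apply: contraNneq ncHH => M1; apply/commG1P/trivgP; rewrite -M1.
by left; apply: sub_der1_abelian.
Qed.

Theorem theorem5p15 (R : realType) (gT rT : finGroupType)
    (G : {group gT}) (H : {group rT}) :
  isoclinic G H ->
  totally_unramified R[i] G ->
  totally_unramified R[i] H.
Proof.
by move/isoclinic_common_cover; apply: totally_unramified_cover.
Qed.
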